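(* Let $k$ be any positive integer. Then $\alpha(Q_8 \times C_2^k) = 16 + 2k$.
   Context: All graphs are finite, simple and undirected. For a finite group $G$, $\alpha(G)$ denotes the minimum number of vertices of a graph $\Gamma$ whose full automorphism group $\mathrm{Aut}\,\Gamma$ is isomorphic to $G$. $Q_8=\langle \sigma,\tau \mid \sigma^4=\tau^4=1,\ \sigma^2=\tau^2,\ \sigma\tau=\tau\sigma^{-1}\rangle$ is the quaternion group of order $8$, and $C_2^k$ is the elementary abelian group of order $2^k$ (direct product of $k$ copies of the cyclic group $C_2$ of order $2$). *)

(* Defs.v *)
From mathcomp Require Import all_boot all_fingroup all_algebra all_solvable.
Set Implicit Arguments. Unset Strict Implicit. Unset Printing Implicit Defensive.

Definition simple_graph (n : nat) (e : rel 'I_n) : Prop :=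
  irreflexive e /\ symmetric e.

Definition graph_aut (n : nat) (e : rel 'I_n) : {set {perm 'I_n}} :=
  [set p : {perm 'I_n} | [forall x, forall y, e (p x) (p y) == e x y]].

Definition is_alpha (gT : finGroupType) (G : {set gT}) (m : nat) : Prop :=
  (exists e : rel 'I_m, simple_graph e /\ (graph_aut e \isog G)%g) /\
  (forall (n : nat) (e : rel 'I_n), simple_graph e ->
      (graph_aut e \isog G)%g -> m <= n).

(* Q_8 x C_2^k : 'Q_8 is mathcomp's quaternion group of order 8, and the
   additive group of 'rV['Z_2]_k is elementary abelian of order 2^k. *)
Definition Q8xC2k (k : nat) : {set ('Q_8 * 'rV['Z_2]_k)%type} :=
  [set: ('Q_8 * 'rV['Z_2]_k)%type].

(* Main.v *)
Require Import Defs.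
From mathcomp Require Import all_boot all_fingroup all_algebra all_solvable.
Set Implicit Arguments. Unset Strict Implicit. Unset Printing Implicit Defensive.

(** Write G for Aut Γ, Z for its centre and z for the common square of its
    noncentral elements.

    Lower bound.  If z moves x, the stabiliser H1 of x contains no square z, so
    it is central and fixes the orbit O1 of x pointwise.  On the Cayley graph
    induced on O1, multiplying by z off the Z-orbit of x is an automorphism,
    because the connection set meets the noncentral elements in an inverse-closed
    set; were it compatible with the rest of Γ it would be an element of G fixing
    x but not O1.  Hence some y outside O1 is adjacent to exactly one of w and
    z w, for some w in O1.  Then z moves y, and, if H2 is the stabiliser of y and
    O2 its orbit, z is not in H1 H2, so 8 |H1 H2| <= |G|, that is
    8 |G| <= |O1| |O2| |K| with K the intersection of H1 and H2.  A 2-power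
    o >= 8 satisfies 4 o^2 <= 2^o, and the abelian 2-group K, moving m points,
    satisfies |K|^2 <= 2^m; so 2^10 |G|^2 <= 2^n, and |G| = 2^(k+3).

    Upper bound.  Starting from a 16-vertex graph with automorphism group Q_8,
    add two isolated vertices and take the complement, k times: each step
    multiplies the group by C_2. *)

(** * Inequalities between powers of 2 and their exponents *)

Lemma double_leq_exp2 b : 2 * b <= 2 ^ b.
Proof. by case: b => // b; rewrite expnS leq_mul2l /= ltn_expl. Qed.

Lemma double_add2_leq_exp2 b : 2 < b -> 2 * b + 2 <= 2 ^ b.
Proof.
case: b => [|[|[|b]]] // _; elim: b => // b IHb.
rewrite expnS (mul2n (2 ^ _)) -addnn mulnSr; apply: leq_add IHb _.
by rewrite -{1}(expn1 2) leq_exp2l.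
Qed.

(** * Orbits and stabilisers in permutation 2-groups *)

Section Orbits.

Variables (T : finType) (G : {group {perm T}}).

Lemma orbit_permP (x y : T) :
  reflect (exists2 p, p \in G & y = p x) (y \in orbit 'P G x)%g.
Proof. by apply: (iffP orbitP) => -[p Gp]; exists p. Qed.

Lemma stab_permP (x : T) (p : {perm T}) :
  reflect (p \in G /\ p x = x) (p \in 'C_G[x | 'P])%g.
Proof.
apply: (iffP setIP) => -[Gp]; first by move/astab1P.
by move=> px; split=> //; apply/astab1P.
Qed.

Lemma central_stab_orbit (x y : T) (p : {perm T}) :
  p \in 'Z(G)%g -> p x = x -> y \in orbit 'P%act G x -> p y = y.
Proof.
move=> /centerP[_ cGp] px /orbit_permP[g Gg ->].
by rewrite -permM -cGp // permM px.
Qed.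

Lemma card_orbit_2group (x : T) :
  2.-group%g G -> exists b, #|orbit 'P%act G x| = 2 ^ b.
Proof.
move=> pG; have /p_natP[b ->] : 2.-nat #|orbit 'P%act G x|; last by exists b.
by apply: pnat_dvd pG; rewrite -(card_orbit_stab 'P G x) dvdn_mulr.
Qed.

End Orbits.

(** Induct on |S|: as E is abelian, the stabiliser of x fixes its orbit O pointwise, so it moves
    only points of S outside O; and |O|^2 <= 2^|O| because |O| is a power of 2. *)
Lemma abelian_2group_degree (T : finType) (E : {group {perm T}}) (S : {set T}) :
  abelian E -> 2.-group%g E -> {in E, forall p, perm_on S p} ->
  #|E| ^ 2 <= 2 ^ #|S|.
Proof.
elim: {S}_.+1 {-2}S (ltnSn #|S|) E => // n IHn S leSn E cEE pE onS.
have [S0|[x Sx]] := set_0Vmem S.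
  have /trivgP -> : E \subset [1 {perm T}]%g.
    apply/subsetP=> p /onS /subsetP onSp; apply/set1P/permP=> y; rewrite perm1.
    by apply/eqP; apply: contraT => /onSp; rewrite S0 inE.
  by rewrite cards1 expn_gt0.
set O := orbit 'P%act E x.
have sOS: O \subset S.
  by apply/subsetP=> y /orbit_permP[p Ep ->]; rewrite (perm_closed _ (onS p Ep)).
have sKE: 'C_E[x | 'P]%g \subset E := subsetIl _ _.
have onSO: {in 'C_E[x | 'P]%g, forall p, perm_on (S :\: O) p}.
  move=> p /stab_permP[Ep px]; apply/subsetP=> y py; rewrite inE andbC.
  rewrite (subsetP (onS p Ep)) //=; apply: contraNN py => Oy; apply/eqP.
  by apply: central_stab_orbit px Oy; rewrite (center_idP cEE).
have cardSO: #|S| = #|O| + #|S :\: O|.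
  by rewrite -(cardsID O S) (setIidPr sOS).
have O_gt0: 0 < #|O| by apply/card_gt0P; exists x; apply: orbit_refl.
have leKn: #|S :\: O| < n by move: leSn; rewrite cardSO ltnS; apply: leq_trans; rewrite -add1n leq_add2r.
have := IHn _ leKn 'C_E[x | 'P]%G (abelianS sKE cEE) (pgroupS sKE pE) onSO.
rewrite -(card_orbit_stab 'P E x) -/O cardSO expnMn expnD; apply: leq_mul.
have [b ->] := card_orbit_2group x pE.
by rewrite -expnM leq_exp2l // mulnC double_leq_exp2.
Qed.

(** * Lower bound on the number of vertices *)

Section LowerBound.

Variables (T : finType) (e : rel T) (G : {group {perm T}}) (z : {perm T}).
Hypothesis e_sym : symmetric e.
Hypothesis autG : forall p : {perm T}, reflect (forall x y, e (p x) (p y) = e x y) (p \in G).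
Hypothesis Zz : z \in 'Z(G)%g.
Hypothesis z_neq1 : z != 1%g.
Hypothesis sqrZ : {in 'Z(G)%g, forall g, g ^+ 2 = 1}%g.
Hypothesis sqrNZ : {in G :\: 'Z(G), forall g, g ^+ 2 = z}%g.
Hypothesis cardG : #|G| = 4 * #|'Z(G)%g|.
Hypothesis pG : 2.-group%g G.

Let Gz : z \in G. Proof. by case/centerP: Zz. Qed.

Let zz x : z (z x) = x.
Proof. by rewrite -permM -[(z * z)%g]/(z ^+ 2)%g sqrZ ?perm1. Qed.

Let sZG : 'Z(G)%g \subset G := center_sub G.

(** A noncentral element fixing x would have its square [z] fixing x. *)
Lemma stab_sub_center x : z x != x -> 'C_G[x | 'P]%g \subset 'Z(G)%g.
Proof.
move=> zx; apply/subsetP=> g Hg; have [Gg gx] := stab_permP _ _ _ Hg.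
apply: contraNT zx => nZg; have <- : (g ^+ 2)%g = z by apply: sqrNZ; rewrite inE nZg.
by rewrite permM !gx.
Qed.

Lemma moved_orbit x y : z x != x -> y \in orbit 'P%act G x -> z y != y.
Proof.
move=> zx /orbit_permP[g Gg ->]; have [_ cz] := centerP _ _ Zz.
by rewrite -permM -cz // permM (inj_eq perm_inj).
Qed.

(* Otherwise applying [z] on the part of the orbit of [x] outside the
   ['Z(G)]-orbit of [x], and nothing elsewhere, would be an automorphism fixing
   [x] but not its whole orbit; a central element cannot do this. *)
Lemma asymmetric_neighbour x : z x != x ->
  exists y w, [/\ y \notin orbit 'P%act G x, w \in orbit 'P%act G x
                & e w y != e (z w) y].
Proof.
move=> zx; set O := orbit 'P%act G x.
case: (boolP [exists y, [exists w, [&& y \notin O, w \in O & e w y != e (z w) y]]]).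
  by move/existsP=> [y /existsP[w /and3P[]]]; exists y, w.
move=> noP; exfalso.
have sameO y w : y \notin O -> w \in O -> e (z w) y = e w y.
  move=> Oy Ow; apply/eqP; rewrite eq_sym; apply: contraNT noP => ne.
  by apply/existsP; exists y; apply/existsP; exists w; rewrite Oy Ow.
pose B := O :\: orbit 'P%act 'Z(G) x.
have zB y : (z y \in B) = (y \in B).
  by rewrite !inE -[z y]/('P%act y z) !orbit_actr.
pose f y := if y \in B then z y else y.
have fK : involutive f.
  by move=> y; rewrite /f; case By: (y \in B); rewrite ?zB By ?zz.
have f_inj := inv_inj fK.
have e_z u v : e (z u) (z v) = e u v by apply: (autG _ Gz).
have eB u v : u \in B -> v \notin B -> e (z u) v = e u v.
  rewrite !inE negb_and negbK => /andP[nZu Ou] /orP[Zv|]; last by move/sameO->.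
  have /orbit_permP[c Zc ->] := Zv; have Gc := subsetP sZG _ Zc.
  have /orbit_permP[g Gg def_u] := Ou.
  (* Now u = c w x and v = c x with w noncentral, so w^2 = z. Applying c^-1, z and w^-1 in turn
     carries (z u, v) to (x, w x), while c^-1 carries (u, v) to (w x, x); symmetry of [e]
     concludes. *)
  pose w : {perm T} := (g * c^-1)%g; have Gw : w \in G by rewrite groupM ?groupV.
  have nZw : w \notin 'Z(G)%g.
    rewrite groupMr ?groupV //; apply: contra nZu => Zg.
    by rewrite def_u; apply: mem_orbit.
  have w2 : (w ^+ 2 = z)%g by apply: sqrNZ; rewrite inE nZw.
  have -> : u = c (w x) by rewrite def_u /w permM permKV.
  have [_ cz] := centerP _ _ Zz.
  rewrite -permM -cz // permM !(autG _ Gc).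
  have wwx : w (w x) = z x by rewrite -w2 (permM w w).
  by rewrite -e_z zz -wwx (autG _ Gw) e_sym.
have Gf : perm f_inj \in G.
  apply/autG=> u v; rewrite !permE /f.
  case: (boolP (u \in B)) => Bu; case: (boolP (v \in B)) => Bv //.
  - exact: eB.
  - by rewrite e_sym eB // e_sym.
have Zf : perm f_inj \in 'Z(G)%g.
  apply: (subsetP (stab_sub_center zx)); apply/stab_permP; split=> //.
  by rewrite permE /f inE orbit_refl.
have [g Gg nZg] : exists2 g, g \in G & g \notin 'Z(G)%g.
  apply/subsetPn; apply/negP=> /subset_leq_card; rewrite cardG.
  by rewrite leqNgt -{1}[#|_|]mul1n ltn_pmul2r ?cardG_gt0.
have Ogx : g x \in O by apply: mem_orbit.
have Bgx : g x \in B.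
  rewrite inE Ogx andbT; apply: contra nZg => /orbit_permP[c Zc cg].
  rewrite -(groupMr _ (groupVr Zc)); apply: (subsetP (stab_sub_center zx)).
  apply/stab_permP; split; first by rewrite groupM ?groupV // (subsetP sZG).
  by rewrite permM cg -permM mulgV perm1.
have := central_stab_orbit Zf _ Ogx; rewrite !permE /f Bgx inE orbit_refl.
by move/(_ erefl)/eqP; apply/negP; apply: moved_orbit Ogx.
Qed.

Lemma card_center_avoiding (M : {group {perm T}}) :
  M \subset 'Z(G)%g -> z \notin M -> 8 * #|M| <= #|G|.
Proof.
move=> sMZ nMz; rewrite cardG -[8]/(4 * 2)%N -mulnA leq_pmul2l //.
rewrite -(Lagrange sMZ) mulnC leq_pmul2l ?cardG_gt0 // indexg_gt1.
by apply: contra nMz => /subsetP->.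
Qed.

(** The orbit has length at least |G| / |M| >= 8, and this length is a power of 2. *)
Lemma card_orbit_stab_avoiding (M : {group {perm T}}) x :
    M \subset 'Z(G)%g -> z \notin M -> 'C_G[x | 'P]%g \subset M ->
  4 * #|orbit 'P%act G x| ^ 2 <= 2 ^ #|orbit 'P%act G x|.
Proof.
move=> sMZ nMz sHM; have := card_center_avoiding sMZ nMz.
rewrite -(card_orbit_stab 'P G x); have [b ->] := card_orbit_2group x pG.
move=> le8; have b_gt2 : 2 < b.
  rewrite -(leq_exp2l _ _ (ltnSn 1)) -(leq_pmul2r (cardG_gt0 'C_G[x | 'P]%G)).
  by apply: leq_trans le8; rewrite leq_mul2l subset_leq_card.
by rewrite -expnM -(expnD 2 2) leq_exp2l // addnC mulnC double_add2_leq_exp2.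
Qed.

Lemma card_aut_bound : 2 ^ 10 * #|G| ^ 2 <= 2 ^ #|T|.
Proof.
have [x zx] : exists x, z x != x.
  apply/existsP; apply: contraNT z_neq1; rewrite negb_exists => /forallP fix_z.
  by apply/eqP/permP=> x; rewrite perm1; apply/eqP; rewrite -[_ == _]negbK.
have [y [w [Oy Ow ne]]] := asymmetric_neighbour zx.
have e_z u v : e (z u) (z v) = e u v by apply: (autG _ Gz).
(* If z fixed y, it would carry the pair (w, y) to (z w, y). *)
have zy : z y != y by apply: contraNneq ne => zy; rewrite -{2}zy e_z.
set H1 := 'C_G[x | 'P]%G; set H2 := 'C_G[y | 'P]%G.
have sH1 : H1 \subset 'Z(G)%g := stab_sub_center zx.
have sH2 : H2 \subset 'Z(G)%g := stab_sub_center zy.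
have defM : (H1 <*> H2 = H1 * H2)%g.
  apply: cent_joinEr; apply: subset_trans sH2 _; apply: subset_trans (subsetIr _ _) _.
  by apply: centS; apply: subsetIl.
have sMZ : (H1 <*> H2)%g \subset 'Z(G)%g by rewrite join_subG sH1.
have nMz : z \notin (H1 <*> H2)%g.
  (* If z = h1 h2, then h1 fixes w and sends y to z y, so e w y = e w (z y) = e (z w) y, against the
     choice of y and w. *)
  rewrite defM; apply/negP=> /mulsgP[h1 h2 Hh1 Hh2 def_z].
  have Zh1 := subsetP sH1 _ Hh1; have Zh2 := subsetP sH2 _ Hh2.
  have [Gh1 h1x] := stab_permP _ _ _ Hh1; have [_ h2y] := stab_permP _ _ _ Hh2.
  have [_ ch1] := centerP _ _ Zh1; have [Gh2 _] := centerP _ _ Zh2.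
  have h1y : h1 y = z y by rewrite def_z ch1 // permM h2y.
  have h1w : h1 w = w by apply: central_stab_orbit h1x Ow.
  by case/eqP: ne; rewrite -(autG _ Gh1) h1w h1y -e_z zz.
set O1 := orbit 'P%act G x in Oy Ow; set O2 := orbit 'P%act G y.
have dO : [disjoint O1 & O2].
  apply/pred0P=> u /=; apply/negP=> /andP[O1u O2u]; case/negP: Oy.
  by rewrite /O1 -(orbit_eqP O1u) (orbit_eqP O2u) orbit_refl.
have boundK : #|(H1 :&: H2)%g| ^ 2 <= 2 ^ #|~: (O1 :|: O2)|.
  have sKZ : (H1 :&: H2)%g \subset 'Z(G)%g by apply: subset_trans (subsetIl _ _) _.
  apply: (@abelian_2group_degree _ (H1 :&: H2)%G).
  - exact: abelianS sKZ (center_abelian _).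
  - exact: pgroupS (subset_trans sKZ sZG) pG.
  move=> p Kp; have Zp := subsetP sKZ _ Kp; case/setIP: Kp.
  move=> /stab_permP[_ px] /stab_permP[_ py].
  apply/subsetP=> u; rewrite !inE; apply: contraNN => /orP[] Ou; apply/eqP.
    exact: central_stab_orbit px Ou.
  exact: central_stab_orbit py Ou.
have cardT : #|T| = #|O1| + #|O2| + #|~: (O1 :|: O2)|.
  by rewrite -(cardsC (O1 :|: O2)) cardsU disjoint_setI0 // cards0 subn0.
have bound1 : 4 * #|O1| ^ 2 <= 2 ^ #|O1|.
  by apply: card_orbit_stab_avoiding sMZ nMz _; apply: joing_subl.
have bound2 : 4 * #|O2| ^ 2 <= 2 ^ #|O2|.
  by apply: card_orbit_stab_avoiding sMZ nMz _; apply: joing_subr.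
have boundG : 8 * #|G| <= #|O1| * #|O2| * #|(H1 :&: H2)%g|.
  rewrite -(leq_pmul2r (cardG_gt0 (H1 <*> H2)%G)).
  (* This combines |O1| |H1| = |G| = |O2| |H2| with |H1 H2| |K| = |H1| |H2|. *)
  have -> : #|O1| * #|O2| * #|(H1 :&: H2)%g| * #|(H1 <*> H2)%G| = #|G| * #|G|.
    rewrite -mulnA [X in _ * _ * X]mulnC /= defM -mul_cardG mulnACA.
    by congr (_ * _)%N; apply: card_orbit_stab.
  by rewrite mulnAC leq_pmul2r ?cardG_gt0 // (card_center_avoiding sMZ nMz).
rewrite cardT !expnD.
apply: leq_trans (leq_mul (leq_mul bound1 bound2) boundK).
have := leq_mul boundG boundG; rewrite !mulnn !expnMn => boundG2.
(* The factor 16 is absorbed by the two orbit bounds, and 8^2 comes from squaring [boundG]. *)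
have -> : 2 ^ 10 * #|G| ^ 2 = 16 * (8 ^ 2 * #|G| ^ 2) by rewrite mulnA.
have -> : 4 * #|O1| ^ 2 * (4 * #|O2| ^ 2) * #|(H1 :&: H2)%g| ^ 2 =
    16 * (#|O1| ^ 2 * #|O2| ^ 2 * #|(H1 :&: H2)%g| ^ 2).
  by rewrite mulnACA -mulnA.
by rewrite leq_mul2l.
Qed.

End LowerBound.

(** * Centre and squares of Q_8 x C_2^k *)

Lemma card_Q8 : #|[set: 'Q_8]| = 8.
Proof. exact: (@card_quaternion 3). Qed.

(** All squares lie in the centre <x^2>, of order 2, and x^2 is the only involution; hence a
    noncentral element cannot have square 1. *)
Lemma Q8_squares : exists c : 'Q_8,
  [/\ c \in 'Z([set: 'Q_8])%g, c != 1%g, #|'Z([set: 'Q_8])%g| = 2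
    & forall g : 'Q_8, (g ^+ 2)%g = if g \in 'Z([set: 'Q_8])%g then 1%g else c].
Proof.
have isoQ : [set: 'Q_8] \isog [set: 'Q_(2 ^ 3)] by apply: isog_refl.
have [[x y] genQ _] := generators_quaternion (erefl : 2 < 3) isoQ.
have [_ _ [defZ oZ inv _ /(_ 1 erefl) mho] _ _] :=
  quaternion_structure (erefl : 2 < 3) genQ isoQ.
rewrite expn1 in defZ inv mho.
have ox2 : #[x ^+ 2]%g = 2 by rewrite /order -defZ.
exists (x ^+ 2)%g; split=> //; first by rewrite defZ cycle_id.
  by rewrite -order_eq1 ox2.
move=> g; case: ifP => [Zg | nZg].
  by have := order_dvdG Zg; rewrite oZ order_dvdn => /eqP.
have : (g ^+ 2)%g \in <[x ^+ 2]>%g.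
  rewrite -mho -[2]/(2 ^ 1)%N; apply: Mho_p_elt; first by rewrite inE.
  apply: (@mem_p_elt _ _ _ [set: 'Q_8]%G); last by rewrite inE.
  by rewrite /pgroup card_Q8.
rewrite (cycle2g ox2) !inE => /orP[/eqP g2|/eqP //].
have : #[g]%g %| 2 by rewrite order_dvdn g2.
rewrite dvdn_divisors // !inE => /orP[].
  by rewrite order_eq1 => /eqP g1; rewrite g1 group1 in nZg.
by move=> /eqP /(inv g (in_setT g)) gx; rewrite gx defZ cycle_id in nZg.
Qed.

Lemma center_Q8xC2k k : 'Z(Q8xC2k k)%g = setX 'Z([set: 'Q_8])%g [set: 'rV['Z_2]_k].
Proof.
apply/setP=> -[q v]; rewrite !inE /= andbT.
apply/centP/centP => [cqv g _ | cq [g u] _].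
  by have [] := cqv (g, 1%g) (in_setT _).
by congr (_, _); [apply: cq; rewrite inE | apply: GRing.addrC].
Qed.

Lemma mem_center_Q8xC2k k (q : 'Q_8) (v : 'rV['Z_2]_k) :
  ((q, v) \in 'Z(Q8xC2k k)%g) = (q \in 'Z([set: 'Q_8])%g).
Proof. by rewrite center_Q8xC2k in_setX in_setT andbT. Qed.

Lemma sqr_Q8xC2k k (q : 'Q_8) (v : 'rV['Z_2]_k) :
  ((q, v) ^+ 2 = ((q ^+ 2)%g, 1) :> 'Q_8 * 'rV['Z_2]_k)%g.
Proof.
congr (_, _); apply/rowP=> i; rewrite !mxE.
by case: (v ord0 i) => -[|[|]] // ?; apply/val_inj.
Qed.

Lemma card_Q8xC2k k : #|Q8xC2k k| = 2 ^ (3 + k).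
Proof.
by rewrite cardsT card_prod -cardsT card_Q8 card_mx card_ord mul1n expnD.
Qed.

Lemma card_center_Q8xC2k k : #|Q8xC2k k| = 4 * #|'Z(Q8xC2k k)%g|.
Proof.
have [c [_ _ oZ _]] := Q8_squares.
by rewrite center_Q8xC2k cardsX oZ card_Q8xC2k cardsT card_mx card_ord mul1n mulnA expnD.
Qed.

(** * Graph automorphism groups and the bound 16 + 2k *)

Lemma graph_autP n (e : rel 'I_n) (p : {perm 'I_n}) :
  reflect (forall x y, e (p x) (p y) = e x y) (p \in graph_aut e).
Proof.
rewrite inE; apply: (iffP forallP) => H x; first by move=> y; apply/eqP/(forallP (H x)).
by apply/forallP=> y; rewrite H.
Qed.

Lemma graph_aut_group_set n (e : rel 'I_n) : group_set (graph_aut e).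
Proof.
apply/group_setP; split=> [|p q /graph_autP eP /graph_autP eQ].
  by apply/graph_autP=> x y; rewrite !perm1.
by apply/graph_autP=> x y; rewrite !permM eQ eP.
Qed.

Canonical graph_aut_group n (e : rel 'I_n) := Group (graph_aut_group_set e).

(** The role of [z] is played by the image of (c, 1). As |G| = 2^(3+k), the bound 2^10 |G|^2 <= 2^n
    reads 10 + 2 (3 + k) <= n. *)
Lemma Q8xC2k_degree k n (e : rel 'I_n) :
  simple_graph e -> graph_aut e \isog Q8xC2k k -> 16 + 2 * k <= n.
Proof.
move=> [_ e_sym] /isog_symr/isogP[f injf im_f].
have [c [Zc c_neq1 _ sqrQ]] := Q8_squares.
have [imZ domT] : (f @* 'Z(Q8xC2k k) = 'Z(graph_aut e))%g /\ forall u, u \in Q8xC2k k.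
  by rewrite -im_f injm_center //; split=> // u; rewrite inE.
have sZT : ('Z(Q8xC2k k) \subset Q8xC2k k)%g := center_sub _.
have cardA : #|graph_aut e| = #|Q8xC2k k| by rewrite -im_f card_injm.
have Zcu : (c, 1%g) \in 'Z(Q8xC2k k)%g by rewrite mem_center_Q8xC2k.
have sqrf u : (f u ^+ 2)%g = if u \in 'Z(Q8xC2k k)%g then 1%g else f (c, 1%g).
  rewrite -morphX //; case: u => q v; rewrite sqr_Q8xC2k sqrQ mem_center_Q8xC2k.
  by case: ifP => // _; rewrite morph1.
have : 2 ^ 10 * #|graph_aut e| ^ 2 <= 2 ^ #|'I_n|.
  apply: (@card_aut_bound _ e (graph_aut_group e) (f (c, 1%g))) => //=.
  - exact: graph_autP.
  - by rewrite -imZ mem_morphim.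
  - by rewrite -(morph1 f) (inj_in_eq (injmP injf)) // xpair_eqE negb_and c_neq1.
  - by move=> g; rewrite -imZ => /morphimP[u _ Zu ->]; rewrite sqrf Zu.
  - move=> g; rewrite -imZ -im_f => /setDP[/morphimP[u Tu _ ->]] nZfu.
    by rewrite sqrf ifN //; apply: contra nZfu; apply: mem_morphim.
  - by rewrite cardA card_center_Q8xC2k -imZ card_injm.
  - by rewrite /pgroup cardA card_Q8xC2k pnatX.
rewrite cardA card_Q8xC2k card_ord -expnM -expnD leq_exp2l //.
by rewrite mulnDl addnA [k * 2]mulnC.
Qed.

(** * Multiplying the automorphism group by C_2 *)

(** An arbitrary finite vertex type lets vertices be added by a sum type, with renumbering left to
    the end. *)
Definition aut_iso (gT : finGroupType) (T : finType) (e : rel T)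
    (f : gT -> {perm T}) : Prop :=
  [/\ {morph f : g h / (g * h)%g}, injective f
    & forall p : {perm T},
        (forall x y, e (p x) (p y) = e x y) <-> exists g, p = f g].

(** An invariant of the construction, by which the next added pair can be told from the old
    vertices. *)
Definition no_isolated (T : finType) (e : rel T) : Prop := forall x, exists y, e x y.

Section AddPair.

Variables (T : finType) (e : rel T).
Hypotheses (e_irr : irreflexive e) (e_sym : symmetric e) (e_iso : no_isolated e).

(** The complement of the disjoint union of [e] and two isolated vertices. *)
Definition with_pair (u v : T + bool) : bool :=
  match u, v with
  | inl x, inl y => (x != y) && ~~ e x y
  | inr b, inr c => b != c
  | _, _ => true
  end.

Lemma with_pair_irr : irreflexive with_pair.
Proof. by case=> x /=; rewrite eqxx. Qed.

Lemma with_pair_sym : symmetric with_pair.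
Proof. by move=> [x|b] [y|c] //=; rewrite eq_sym // e_sym. Qed.

Lemma with_pair_no_isolated : no_isolated with_pair.
Proof. by case=> x; [exists (inr true) | exists (inr (~~ x)); case: x]. Qed.

Definition pair_act (p : {perm T}) (b : bool) (u : T + bool) : T + bool :=
  match u with inl x => inl (p x) | inr c => inr (c (+) b) end.

Lemma pair_act_inj p b : injective (pair_act p b).
Proof. by move=> [x|c] [y|d] //= [] => [/perm_inj|/addIb] ->. Qed.

Definition pair_perm p b : {perm T + bool} := perm (@pair_act_inj p b).

Lemma pair_perm_aut (p : {perm T}) b :
  (forall x y, e (p x) (p y) = e x y) ->
  forall u v, with_pair (pair_perm p b u) (pair_perm p b v) = with_pair u v.
Proof.
move=> pP [x|c] [y|d] //=; rewrite !permE //=; first by rewrite (inj_eq perm_inj) pP.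
by rewrite (inj_eq (@addIb b)).
Qed.

(* The added vertices are the dominating ones. *)
Lemma with_pair_aut (p : {perm T + bool}) :
  (forall u v, with_pair (p u) (p v) = with_pair u v) ->
  exists (q : {perm T}) b, (forall x y, e (q x) (q y) = e x y) /\ p = pair_perm q b.
Proof.
move=> pP; pose dom u := [forall v, (v != u) ==> with_pair u v].
have dom_p u : dom u -> dom (p u).
  move=> /forallP du; apply/forallP=> v; apply/implyP=> nvu.
  rewrite -[v](permKV p) pP; apply: (implyP (du _)).
  by apply: contraNneq nvu => <-; rewrite permKV.
have domr b : dom (inr b).
  by case: b; apply/forallP=> -[y|[]]; rewrite ?implybT.
(* A neighbour of x in [e] is a non-neighbour of [inl x] in the complement. *)
have doml x : dom (inl x) = false.
  have [y exy] := e_iso x; apply/negbTE/forallPn; exists (inl y) => /=.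
  by rewrite exy andbF implybF negbK; apply: contraTneq exy => -[->]; rewrite e_irr.
have pr b : {c | p (inr b) = inr c}.
  by case def_c: (p (inr b)) (dom_p _ (domr b)) => [x|c]; [rewrite doml | exists c].
have [[c1 pc1] [c0 pc0]] := (pr true, pr false).
have c01 : c0 = ~~ c1.
  have : p (inr true) != p (inr false) by rewrite (inj_eq perm_inj).
  by rewrite pc1 pc0; case: (c1) (c0) => [] [].
have pl x : {y | p (inl x) = inl y}.
  case def_p: (p (inl x)) => [y|c]; first by exists y.
  (* The image [inr c] is already taken by [inr (c == c1)]. *)
  suff /perm_inj : p (inl x) = p (inr (c == c1)) by [].
  rewrite def_p; case: eqVneq => [->|]; rewrite ?pc1 ?pc0 ?c01 //.
  by case: (c) (c1) => [] [].
pose q0 x := sval (pl x).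
have q0P x : p (inl x) = inl (q0 x) by rewrite /q0; case: (pl x).
have q0_inj : injective q0.
  by move=> x y q0xy; have [] : @inl T bool x = inl y by apply: (@perm_inj _ p); rewrite !q0P q0xy.
(* The swap bit b is the solution of true (+) b = c1. *)
exists (perm q0_inj), (~~ c1); split=> [x y|].
  rewrite !permE; have := pP (inl x) (inl y); rewrite !q0P /= (inj_eq q0_inj).
  by case: eqVneq => [->|_ /negb_inj]; rewrite ?e_irr.
apply/permP=> -[x|b]; rewrite permE /= ?q0P ?permE //.
by case: b; rewrite ?pc1 ?pc0 ?c01 //= negbK.
Qed.

(** The maps [pr] and [bt] present [hT] as a direct product of [gT] and C_2; in this form row
    vectors with one more coordinate fit directly. *)
Lemma with_pair_aut_iso (gT hT : finGroupType) (f : gT -> {perm T})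
    (pr : hT -> gT) (bt : hT -> bool) :
    aut_iso e f -> {morph pr : g h / (g * h)%g} ->
    {morph bt : g h / (g * h)%g >-> g (+) h} ->
    (forall g h, pr g = pr h -> bt g = bt h -> g = h) ->
    (forall g b, exists2 h, pr h = g & bt h = b) ->
  aut_iso with_pair (fun h => pair_perm (f (pr h)) (bt h)).
Proof.
move=> [fM f_inj f_aut] prM btM inj surj; split.
- move=> g h; apply/permP=> -[x|c]; rewrite permM !permE /= ?prM ?btM ?fM ?permM //.
  by rewrite addbA.
- move=> g h /permP eq_gh; apply: inj.
    apply: f_inj; apply/permP=> x.
    by have := eq_gh (inl x); rewrite !permE => -[].
  by have := eq_gh (inr false); rewrite !permE => -[].
- move=> p; split=> [/with_pair_aut[q [b [/f_aut[g ->] ->]]] | [h ->]].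
    by have [h <- <-] := surj g b; exists h.
  by apply: pair_perm_aut; apply/f_aut; exists (pr h).
Qed.

End AddPair.

(** Splits off the first coordinate; in Z_2, being nonzero turns addition into exclusive or. *)
Lemma Q8xrV_recl k :
  let pr (u : 'Q_8 * 'rV['Z_2]_k.+1) := (u.1, (\row_j u.2 ord0 (lift ord0 j) : 'rV['Z_2]_k)%R) in
  let bt (u : 'Q_8 * 'rV['Z_2]_k.+1) := (u.2 ord0 ord0 != 0)%R in
  [/\ {morph pr : g h / (g * h)%g}, {morph bt : g h / (g * h)%g >-> g (+) h},
      (forall g h, pr g = pr h -> bt g = bt h -> g = h)
    & forall g b, exists2 h, pr h = g & bt h = b].
Proof.
have Z2E (a b : 'Z_2) : ((a != 0)%R = (b != 0)%R) -> a = b.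
  by case: a b => [[|[|]] // ?] [[|[|]] // ?] _; apply/val_inj.
split.
- by move=> [q v] [r w]; congr (_, _); apply/rowP=> j; rewrite !mxE.
- move=> [q v] [r w] /=; rewrite mxE.
  by case: (v ord0 ord0) (w ord0 ord0) => [[|[|]] // ?] [[|[|]] // ?].
- move=> [q v] [r w] /= [-> /rowP vw] /Z2E vw0; congr (_, _); apply/rowP=> j.
  by case: (unliftP ord0 j) => [i|] -> //; have := vw i; rewrite !mxE.
- move=> [q v] b.
  exists (q, \row_j if unlift ord0 j is Some i then v ord0 i else (b%:R)%R)%R => /=.
    by congr (_, _); apply/rowP=> j; rewrite !mxE liftK.
  by rewrite mxE unlift_none; case: b.
Qed.

Lemma aut_iso_isog n (e : rel 'I_n) k (f : 'Q_8 * 'rV['Z_2]_k -> {perm 'I_n}) :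
  aut_iso e f -> graph_aut e \isog Q8xC2k k.
Proof.
move=> [fM f_inj f_aut].
rewrite (@isog_sym _ _ (graph_aut_group e) [set: _]%G).
apply/isogP; exists (Morphism (D := [set: 'Q_8 * 'rV['Z_2]_k]) (in2W fM)).
  by apply/injmP=> g h _ _; apply: f_inj.
apply/setP=> p; apply/idP/idP.
  by move=> /morphimP[g _ _ ->]; apply/graph_autP/f_aut; exists g.
move=> /graph_autP/f_aut[g ->].
by apply: (mem_morphim (Morphism (D := [set: 'Q_8 * 'rV['Z_2]_k]) (in2W fM))); rewrite inE.
Qed.

Lemma aut_iso_bij (gT : finGroupType) (T U : finType) (e : rel T)
    (f : gT -> {perm T}) (h : T -> U) (h' : U -> T) :
    cancel h h' -> cancel h' h -> aut_iso e f ->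
  exists f' : gT -> {perm U}, aut_iso (fun u v => e (h' u) (h' v)) f'.
Proof.
move=> hK h'K [fM f_inj f_aut].
have c_inj (p : {perm T}) : injective (h \o p \o h').
  by apply: inj_comp (can_inj h'K); apply: inj_comp (can_inj hK) perm_inj.
exists (fun g => perm (c_inj (f g))); split.
- by move=> g k; apply/permP=> u; rewrite permM !permE /= hK fM permM.
- move=> g k /permP gk; apply/f_inj/permP=> x.
  by have := gk (h x); rewrite !permE /= !hK => /(can_inj hK).
- move=> p; split=> [pP | [g ->] u v]; last first.
    by rewrite !permE /= !hK; apply: (proj2 (f_aut _)); exists g.
  have q_inj : injective (h' \o p \o h).
    by apply: inj_comp (can_inj hK); apply: inj_comp (can_inj h'K) perm_inj.
  have [|g gP] := proj1 (f_aut (perm q_inj)).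
    by move=> x y; rewrite !permE /= pP !hK.
  exists g; apply/permP=> u; have /permP/(_ (h' u)) := gP.
  by rewrite !permE /= h'K => <-; rewrite h'K.
Qed.

(** * Exhaustive search for automorphisms *)

(* A list [l] stands for the map [i |-> nth 0 l i] on [0, ..., size l - 1]. *)
Section Search.

Variables (n : nat) (r : rel nat).

Definition extensions (l : seq nat) : seq (seq nat) :=
  [seq rcons l v | v <- iota 0 n
     & (v \notin l) && all (fun i => r i (size l) == r (nth 0 l i) v) (iota 0 (size l))].

(** Prefixes are pruned at every length, which keeps the search small enough to evaluate. *)
Definition partial_auts (m : nat) : seq (seq nat) :=
  iter m (fun s => flatten (map extensions s)) [:: [::]].

End Search.

(** The images of the first vertices under an automorphism pass every test, so the search misses no
    automorphism. *)
Lemma partial_autsP n (r : rel nat) (p : {perm 'I_n.+1}) m :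
  (forall i j : 'I_n.+1, r (p i) (p j) = r i j) -> m <= n.+1 ->
  [seq val (p (inord i)) | i <- iota 0 m] \in partial_auts n.+1 r m.
Proof.
move=> pP; elim: m => // m IHm lt_mn; have {IHm} IHm := IHm (ltnW lt_mn).
apply/flatten_mapP; exists [seq val (p (inord i)) | i <- iota 0 m] => //.
rewrite -[m.+1]addn1 iotaD map_cat cats1; apply/map_f.
rewrite mem_filter mem_iota ltn_ord /= size_map size_iota !andbT.
apply/andP; split.
  apply/mapP=> -[i]; rewrite mem_iota add0n /= => lt_im /val_inj/perm_inj/(congr1 val) /=.
  rewrite !inordK //; last by apply: ltn_trans lt_mn.
  by move=> eq_mi; rewrite eq_mi ltnn in lt_im.
apply/allP=> i; rewrite mem_iota add0n /= => lt_im.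
rewrite (nth_map 0) ?size_iota // nth_iota // add0n pP.
by rewrite !inordK //; apply: ltn_trans lt_mn.
Qed.

(** * A 16-vertex graph with automorphism group Q_8 *)

(* [x^i y^j] is coded as [i + 4 j], where [x^4 = 1], [y^2 = x^2] and [y x = x^-1 y]. *)
Definition q8_mul (p q : nat) : nat :=
  let s := if p < 4 then p + q else p + (4 - q %% 4) + (if q < 4 then 0 else 2) in
  s %% 4 + 4 * ((p %/ 4 + q %/ 4) %% 2).

(* The vertices [u] and [8 + u] carry two regular representations of [Q_8].  The
   three connection sets come from a computer search. *)
Definition q8_adj (u v : nat) : bool :=
  if u < 8 then
    if v < 8 then v \in [seq q8_mul u s | s <- [:: 1; 2; 3; 4; 6]]
    else v - 8 \in [seq q8_mul u s | s <- [:: 0; 1; 4]]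
  else
    if v < 8 then u - 8 \in [seq q8_mul v s | s <- [:: 0; 1; 4]]
    else v - 8 \in [seq q8_mul (u - 8) s | s <- [:: 1; 3]].

Definition q8_graph : rel 'I_16 := fun u v => q8_adj u v.

Lemma all_ord16 (P : pred nat) : all P (iota 0 16) -> forall i : 'I_16, P i.
Proof. by move=> /allP allP i; apply: allP; rewrite mem_iota ltn_ord. Qed.

Lemma q8_graph_irr : irreflexive q8_graph.
Proof.
move=> i; apply/negbTE; move: i.
by apply: (all_ord16 (P := fun i => ~~ q8_adj i i)); vm_compute.
Qed.

Lemma q8_graph_sym : symmetric q8_graph.
Proof.
move=> i j; apply/eqP; move: j; apply: (all_ord16 (P := fun j => q8_adj i j == q8_adj j i)).
move: i; apply: (all_ord16 (P := fun i => all (fun j => q8_adj i j == q8_adj j i) (iota 0 16))).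
by vm_compute.
Qed.

Lemma q8_graph_no_isolated : no_isolated q8_graph.
Proof.
move=> i.
have : has (q8_adj i) (iota 0 16).
  by move: i; apply: (all_ord16 (P := fun i => has (q8_adj i) (iota 0 16))); vm_compute.
case/hasP=> j; rewrite mem_iota => lt_j eij.
by exists (Ordinal lt_j).
Qed.

(** An automorphism is determined by its list of images, and the search leaves 8 lists. *)
Lemma q8_graph_aut_le8 : #|graph_aut q8_graph| <= 8.
Proof.
pose code (p : {perm 'I_16}) := [seq val (p (inord i)) | i <- iota 0 16].
have code_inj : injective code.
  move=> p q /eq_in_map pq; apply/permP=> i; apply/val_inj.
  by have := pq i; rewrite mem_iota ltn_ord inord_val => ->.
have size8 : size (partial_auts 16 q8_adj 16) = 8 by vm_compute.
apply: leq_trans (eq_leq size8); rewrite cardE -(size_map code); apply: uniq_leq_size.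
  by rewrite map_inj_uniq ?enum_uniq.
move=> l /mapP[p]; rewrite mem_enum => /graph_autP pP ->.
exact: partial_autsP.
Qed.

Section CodedAutomorphism.

Variable h : nat -> nat.

(** The test on the fourth iterate makes the third iterate an inverse, so bijectivity follows from a
    finite check. *)
Definition coded_aut4 : bool :=
  all (fun u => [&& h u < 16, iter 4 h u == u
    & all (fun v => q8_adj (h u) (h v) == q8_adj u v) (iota 0 16)]) (iota 0 16).

Hypothesis h_ok : coded_aut4.

Let hord (i : 'I_16) : 'I_16 := inord (h i).

Let hordE (i : 'I_16) : hord i = h i :> nat.
Proof. by have /and3P[lt _ _] := all_ord16 h_ok i; rewrite inordK. Qed.

Lemma coded_aut4_inj : injective hord.
Proof.
apply: (can_inj (g := iter 3 hord)) => i.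
have /and3P[_ /eqP h4 _] := all_ord16 h_ok i.
by apply/val_inj; rewrite /= !hordE.
Qed.

Definition coded_perm : {perm 'I_16} := perm coded_aut4_inj.

Lemma coded_permE i : coded_perm i = h i :> nat.
Proof. by rewrite permE hordE. Qed.

Lemma coded_perm_aut : coded_perm \in graph_aut q8_graph.
Proof.
apply/graph_autP=> i j; rewrite /q8_graph !coded_permE.
by have /and3P[_ _ /all_ord16/(_ j)/eqP] := all_ord16 h_ok i.
Qed.

End CodedAutomorphism.

(** Left translation on both copies of Q_8; it commutes with the right multiplications that define
    adjacency. *)
Definition q8_trans (g u : nat) : nat :=
  if u < 8 then q8_mul g u else 8 + q8_mul g (u - 8).

(** Two left translations satisfy the quaternion relations and generate at least 8 elements, hence,
    by the search, the whole group; so this is an image of Q_8 of order at least 8. *)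
Lemma q8_graph_aut_isog : [set: 'Q_8] \isog graph_aut q8_graph.
Proof.
pose A := graph_aut_group q8_graph; rewrite -[graph_aut _]/(gval A).
have x_ok : coded_aut4 (q8_trans 1) by vm_compute.
have y_ok : coded_aut4 (q8_trans 4) by vm_compute.
pose x := coded_perm x_ok; pose y := coded_perm y_ok.
have xE i : x i = q8_trans 1 i :> nat by apply: coded_permE.
have yE i : y i = q8_trans 4 i :> nat by apply: coded_permE.
have Ax : x \in A := coded_perm_aut x_ok.
have Ay : y \in A := coded_perm_aut y_ok.
clearbody x y.
have x4 : (x ^+ 4 = 1)%g.
  apply/permP=> i; apply/val_inj; rewrite perm1 !expgS expg0 mulg1 !permM /= !xE.
  by apply/eqP; move: i; apply: (all_ord16 (P := fun i => iter 4 (q8_trans 1) i == i)); vm_compute.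
have y2 : (y ^+ 2 = x ^+ 2)%g.
  apply/permP=> i; apply/val_inj; rewrite !expgS expg0 !mulg1 !permM /= !xE !yE.
  by apply/eqP; move: i; apply: (all_ord16 (P := fun i =>
    q8_trans 4 (q8_trans 4 i) == q8_trans 1 (q8_trans 1 i))); vm_compute.
have xy : (x ^ y = x^-1)%g.
  (* The relation becomes x y x = y, a palindrome, so the order of composition is immaterial. *)
  rewrite conjgE; apply: (canLR (mulKg _)); apply: (canRL (mulgK _)).
  apply/permP=> i; apply/val_inj; rewrite !permM /= !xE !yE !xE.
  by apply/eqP; move: i; apply: (all_ord16 (P := fun i =>
    q8_trans 1 (q8_trans 4 (q8_trans 1 i)) == q8_trans 4 i)); vm_compute.
have x2_neq1 : (x ^+ 2 != 1)%g.
  apply/eqP=> /permP/(_ ord0)/(congr1 val).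
  by rewrite perm1 !expgS expg0 mulg1 permM /= !xE.
have ox2 : #[x ^+ 2]%g = 2 by apply: nt_prime_order; rewrite -?expgM.
have ox : #[x]%g = 4 by rewrite (orderXprime ox2).
have y_notin : y \notin <[x]>%g.
  apply/negP=> /cycleP[i yxi].
  (* Powers of x keep vertex 0 among 0, ..., 3, whereas y sends it to 4. *)
  have : (x ^+ i)%g ord0 < 4.
    elim: i {yxi} => [|i IHi]; first by rewrite expg0 perm1.
    rewrite expgSr permM xE; move: (val _) IHi => u.
    by do 4?case: u => [|u].
  by rewrite -yxi yE.
have sHA : (<[x]> <*> <[y]>)%g \subset A by rewrite join_subG !cycle_subG Ax.
have H_ge8 : 8 <= #|(<[x]> <*> <[y]>)%g|.
  rewrite -(Lagrange (joing_subl <[x]>%G <[y]>%G)) -[#|_|]/(#[x]%g) ox -[8]/(4 * 2)%N leq_mul2l /=.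
  rewrite indexg_gt1; apply: contra y_notin => sHx.
  by apply: (subsetP sHx); apply: (subsetP (joing_subr _ _)); apply: cycle_id.
have defA : (<[x]> <*> <[y]>)%g = A.
  by apply/eqP; rewrite eqEcard sHA (leq_trans q8_graph_aut_le8).
rewrite isog_sym isogEcard card_Q8 -{2}defA H_ge8 andbT.
rewrite (@Grp_quaternion 3 isT); apply/existsP; exists (x, y) => /=.
by rewrite defA x4 y2 xy !xpair_eqE !eqxx.
Qed.

(** * Graphs on 16 + 2k vertices and the value of alpha *)

Lemma Q8xC2k_graph k : exists (T : finType) (e : rel T) (f : 'Q_8 * 'rV['Z_2]_k -> {perm T}),
  [/\ #|T| = 16 + 2 * k, irreflexive e, symmetric e, no_isolated e & aut_iso e f].
Proof.
elim: k => [|k [T [e [f [cardT e_irr e_sym e_iso fP]]]]].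
  have /isogP[f injf im_f] := q8_graph_aut_isog.
  exists 'I_16, q8_graph, (fun g => f g.1); split; rewrite ?card_ord //.
  - exact: q8_graph_irr.
  - exact: q8_graph_sym.
  - exact: q8_graph_no_isolated.
  split=> [g h | [q v] [r w] /= | p]; first by rewrite morphM ?inE.
    move=> /(injmP injf) -> //; rewrite ?inE //; congr (_, _).
    by apply/rowP; case.
  split=> [/graph_autP | [g ->]].
    by rewrite -im_f => /morphimP[q _ _ ->]; exists (q, 0%R).
  by apply/graph_autP; rewrite -im_f mem_morphim ?inE.
have [prM btM inj surj] := Q8xrV_recl k.
exists (T + bool)%type, (with_pair e).
eexists; split; last exact: with_pair_aut_iso fP prM btM inj surj.
- by rewrite card_sum cardT card_bool mulnS [2 + _]addnC addnA.
- exact: with_pair_irr.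
- exact: with_pair_sym.
- exact: with_pair_no_isolated.
Qed.

Theorem theorem3 (k : nat) : 0 < k -> is_alpha (Q8xC2k k) (16 + 2 * k).
Proof.
move=> _; split; last by move=> n e; apply: Q8xC2k_degree.
have [T [e [f [<- e_irr e_sym _ fP]]]] := Q8xC2k_graph k.
have [f' f'P] := aut_iso_bij enum_rankK enum_valK fP.
exists (fun i j => e (enum_val i) (enum_val j)); split; last exact: aut_iso_isog f'P.
by split=> [i | i j]; [apply: e_irr | apply: e_sym].
Qed.
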